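(* Suppose that the climatological distribution $(p_1,\ldots,p_N)\in\mathcal{P}_{\mathrm c}$ satisfies $p_i>0$ for every $i\in[N]$, and let $w_1,\ldots,w_{N-1}$ be nonnegative weights. Define $S:\mathcal{P}_{\mathrm c}\times[N]\to[0,\infty)$ by $$S((r_1,\ldots,r_N),i)=\sum_{k=1}^{N-1}w_k(\mathbf{1}\{R_i<P_k\}-P_k)(\mathbf{1}\{R_k<P_k\}-\mathbf{1}\{k<i\}),$$ where $R_k=\sum_{j=1}^k r_j$ and $P_k=\sum_{j=1}^k p_j$. Then $S$ is equitable with respect to $(p_1,\ldots,p_N)$ and is proper relative to $\mathcal{P}_{\mathrm c}$. The equitability constant is $$\sum_{k=1}^{N-1}w_kP_k(1-P_k).$$
   Context: $[N]=\{1,2,\ldots,N\}$ represents $N$ ordinal categories. $\mathcal{P}_{\mathrm c}$ is the space of probability distributions on $[N]$, each represented by a vector $(r_1,\ldots,r_N)$ of nonnegative components summing to $1$, where $r_i$ is the probability of category $i$. $\mathbf{1}$ denotes the indicator function. $\mathbb{E}_F h(Y)$ denotes the expectation of $h(Y)$ when $Y$ has distribution $F$. A scoring function $S:\mathcal{F}\times\mathcal{O}\to[-\infty,\infty]$ is equitable with respect to a probability distribution $G$ on $\mathcal{O}$ if there is a constant $c\in\mathbb{R}$ (the equitability constant) such that $\mathbb{E}_G S(x,Y)=c$ for every $x\in\mathcal{F}$. A scoring rule $S$ is proper relative to a class $\mathcal{P}_0$ of distributions if $\mathbb{E}_F S(F,Y)\le\mathbb{E}_F S(\tilde F,Y)$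 whenever $F,\tilde F\in\mathcal{P}_0$. *)

(* Defs.v *)
From HB Require Import structures.
From mathcomp Require Import all_boot all_order all_algebra.
From mathcomp Require Import all_classical all_reals all_analysis.

Set Implicit Arguments.
Unset Strict Implicit.
Unset Printing Implicit Defensive.
Import Order.TTheory GRing.Theory Num.Theory.
Local Open Scope classical_set_scope.
Local Open Scope ring_scope.

(* A finite set of outcomes carries its power set as sigma-algebra.  Library
   measurable types are pointed, hence ['I_n.+1]. *)
HB.instance Definition _ (n : nat) := isPointed.Build 'I_n.+1 ord0.
HB.instance Definition _ (n : nat) := @isMeasurable.Build
  default_measure_display 'I_n.+1 discrete_measurable
  discrete_measurable0 discrete_measurableC discrete_measurableU.

Section Scoring.
Context d (O : measurableType d) (R : realType).

(* The integral is total; it is the expectation whenever it exists, as it does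
   for every real-valued score on a finite discrete outcome space. *)
Definition equitability_constant (F : Type) (S : F -> O -> \bar R)
    (G : probability O R) (c : R) : Prop :=
  forall x : F, (\int[G]_y S x y = c%:E)%E.

Definition equitable (F : Type) (S : F -> O -> \bar R)
    (G : probability O R) : Prop :=
  exists c : R, equitability_constant S G c.

(* Scores are penalties: smaller is better. *)
Definition proper_relative_to (P0 : set (probability O R))
    (S : probability O R -> O -> \bar R) : Prop :=
  forall F F' : probability O R, P0 F -> P0 F' ->
    (\int[F]_y S F y <= \int[F]_y S F' y)%E.

End Scoring.

Section Categorical.
Context (n : nat) (R : realType).

(* There are N = n.+1 categories; the ordinal [i], with value in 0..n, stands
   for the category with label [i.+1] in 1..N. *)
Definition label (i : 'I_n.+1) : nat := i.+1.

Definition Pc : set (probability 'I_n.+1 R) := setT.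

(* The components of the vector representing [F]; they are finite because [F]
   is a probability, so [fine] loses nothing. *)
Definition prob (F : probability 'I_n.+1 R) (i : 'I_n.+1) : R :=
  fine (F [set i]).

Definition cumprob (F : probability 'I_n.+1 R) (k : nat) : R :=
  \sum_(j : 'I_n.+1 | (label j <= k)%N) prob F j.

(* [w k] is used only for 1 <= k <= N - 1 = n. *)
Definition score (p : probability 'I_n.+1 R) (w : nat -> R)
    (r : probability 'I_n.+1 R) (i : 'I_n.+1) : R :=
  \sum_(1 <= k < n.+1)
    w k * ((cumprob r (label i) < cumprob p k)%R%:R - cumprob p k)
        * ((cumprob r k < cumprob p k)%R%:R - (k < label i)%N%:R).

End Categorical.

(* Main.v *)
Require Import Defs.
From mathcomp Require Import all_boot all_order all_algebra.
From mathcomp Require Import all_classical all_reals all_analysis.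
From mathcomp Require Import ring lra.
Import Order.TTheory GRing.Theory Num.Theory.
Local Open Scope ring_scope.

(** Write [R_k], [P_k], [F_k] for the cumulative probabilities of the forecast,
    of climatology and of the outcome distribution.

    The [k]-th term of the score, divided by its weight, depends on the forecast
    only through the binary decision [a := R_k < P_k].  If [a] and [k < i] hold
    together, or both fail, the second factor vanishes; otherwise monotonicity
    of [R] shows that [R_i < P_k] and [R_k < P_k] have the same truth value.
    Hence the term is the loss of a two-action problem: deciding [a] costs
    [1 - P_k] when the outcome is at most [k], deciding [~~ a] costs [P_k] when
    the outcome exceeds [k] ([score_lossE]).  This is nonnegative.

    The expected loss under [F] is [(1 - P_k) * F_k] for [a] and
    [P_k * (1 - F_k)] for [~~ a] ([risk], [expected_score]).  The two agree when
    [F_k = P_k], which gives equitability and the constant, and their difference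
    is [F_k - P_k], so the decision [F_k < P_k], which is the one induced by
    forecasting [F] itself, is optimal ([risk_min]). *)

Section FiniteOutcomes.
Context {R : realType} {n : nat}.
Implicit Types F r p : probability 'I_n.+1 R.

Lemma prob_ge0 F i : 0 <= prob F i.
Proof. by rewrite fine_ge0. Qed.

Lemma expectation_ord F (g : 'I_n.+1 -> R) : (forall i, 0 <= g i) ->
  (\int[F]_i (g i)%:E = (\sum_(i < n.+1) g i * prob F i)%:E)%E.
Proof.
move=> g0.
have -> : (fun i => (g i)%:E) =
    (fun i => (\sum_(j < n.+1) (g j)%:E * (\1_[set j]%classic i)%:E)%E).
  apply/funext => i; rewrite (bigD1 i)//= indicE mem_set// mule1.
  rewrite big1 ?adde0// => j ji; rewrite indicE memNset ?mule0// => ij.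
  by rewrite ij eqxx in ji.
rewrite ge0_integral_sum//; last first.
  by move=> j i _; rewrite mule_ge0 ?lee_fin.
rewrite -sumEFin; apply: eq_bigr => j _.
rewrite ge0_integralZl_EFin//=.
by rewrite integral_indic// setIT EFinM /prob fineK// fin_num_measure.
Qed.

Lemma sum_prob F : \sum_(i < n.+1) prob F i = 1.
Proof.
have := expectation_ord F (fun=> 1) (fun=> ler01).
rewrite (integral_cst F measurableT) mul1e.
under eq_bigr do rewrite mul1r.
by move=> /esym E; apply: EFin_inj; rewrite E; exact: probability_setT.
Qed.

Lemma cumprobE F k :
  cumprob F k = \sum_(i < n.+1) (~~ (k < label i)%N)%:R * prob F i.
Proof.
rewrite /cumprob big_mkcond; apply: eq_bigr => i _.
by rewrite -leqNgt; case: ifP; rewrite ?mul1r ?mul0r.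
Qed.

Lemma cumprob_compl F k :
  1 - cumprob F k = \sum_(i < n.+1) (k < label i)%N%:R * prob F i.
Proof.
rewrite -[in LHS](sum_prob F) cumprobE -sumrB; apply: eq_bigr => i _.
by case: (_ < _)%N => /=; ring.
Qed.

Lemma cumprob_homo F : {homo cumprob F : k l / (k <= l)%N >-> k <= l}.
Proof.
move=> k l kl; rewrite !cumprobE; apply: ler_sum => i _.
rewrite ler_wpM2r ?prob_ge0// ler_nat -!leqNgt.
by case: (leqP (label i) k) => // /leq_trans -> .
Qed.

Lemma cumprob_ge0 F k : 0 <= cumprob F k.
Proof. by apply: sumr_ge0 => i _; exact: prob_ge0. Qed.

Lemma cumprob_le1 F k : cumprob F k <= 1.
Proof.
rewrite -subr_ge0 cumprob_compl; apply: sumr_ge0 => i _.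
by rewrite mulr_ge0 ?prob_ge0.
Qed.

End FiniteOutcomes.

Section TwoActionProblem.
Context {R : realType}.

(** Loss of the action [a] when [above] tells whether the outcome exceeds the
    threshold: [a] asserts that it does, which costs [1 - P] when wrong, and [~~ a]
    that it does not, which costs [P] when wrong. *)
Definition loss (P : R) (a above : bool) : R :=
  if a then (1 - P) * (~~ above)%:R else P * above%:R.

(** Expected [loss] of the action [a] when the outcome does not exceed the
    threshold with probability [Q]. *)
Definition risk (P Q : R) (a : bool) : R :=
  if a then (1 - P) * Q else P * (1 - Q).

Lemma loss_ge0 P a above : 0 <= P -> P <= 1 -> 0 <= loss P a above.
Proof.
by move=> P0 P1; rewrite /loss; case: a; rewrite mulr_ge0// subr_ge0.
Qed.

Lemma risk_diag P a : risk P P a = P * (1 - P).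
Proof. by case: a => /=; rewrite // mulrC. Qed.

Lemma risk_min P Q a : risk P Q (Q < P) <= risk P Q a.
Proof. by rewrite /risk; case: ltP => QP; case: a; lra. Qed.

End TwoActionProblem.

Section ScoreAsLoss.
Context {R : realType} {n : nat} (p : probability 'I_n.+1 R) (w : nat -> R).
Implicit Types F r : probability 'I_n.+1 R.

(** Although the first factor of the score compares [P_k] with the cumulative
    forecast at the outcome rather than at [k], each term is a function of the
    forecast at [k] only. *)
Lemma score_lossE r i : score p w r i = \sum_(1 <= k < n.+1)
  w k * loss (cumprob p k) (cumprob r k < cumprob p k) (k < label i)%N.
Proof.
apply: eq_bigr => k _; rewrite -mulrA; congr (_ * _); rewrite /loss.
case: (ltP (cumprob r k)) => rk; case: (ltnP k (label i)) => ki /=.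
- by ring.
- by rewrite (le_lt_trans (cumprob_homo r _ _ ki) rk) /=; ring.
- by rewrite ltNge (le_trans rk (cumprob_homo r _ _ (ltnW ki))) /=; ring.
- by ring.
Qed.

Hypothesis w_ge0 : forall k, (0 < k < n.+1)%N -> 0 <= w k.

Lemma score_ge0 r i : 0 <= score p w r i.
Proof.
rewrite score_lossE big_nat; apply: sumr_ge0 => k /w_ge0 wk.
by rewrite mulr_ge0// loss_ge0 ?cumprob_ge0 ?cumprob_le1.
Qed.

Lemma expected_score F r : (\int[F]_i (score p w r i)%:E =
  (\sum_(1 <= k < n.+1)
    w k * risk (cumprob p k) (cumprob F k) (cumprob r k < cumprob p k)%R)%:E)%E.
Proof.
rewrite expectation_ord; last exact: score_ge0.
congr (_%:E).
under eq_bigr do rewrite score_lossE mulr_suml.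
rewrite exchange_big; apply: eq_bigr => k _ /=.
under eq_bigr do rewrite -mulrA.
rewrite -mulr_sumr; congr (_ * _); rewrite /risk /loss.
by case: ifP => _; rewrite ?(cumprob_compl F) ?(cumprobE F) mulr_sumr;
  apply: eq_bigr => i _; rewrite mulrA.
Qed.

End ScoreAsLoss.

Theorem corollary3 (R : realType) (n : nat) (p : probability 'I_n.+1 R)
    (w : nat -> R)
    (p_gt0 : forall i : 'I_n.+1, 0 < prob p i)
    (w_ge0 : forall k : nat, (0 < k < n.+1)%N -> 0 <= w k) :
  (forall (r : probability 'I_n.+1 R) (i : 'I_n.+1), 0 <= score p w r i) /\
  equitable (fun r i => (score p w r i)%:E) p /\
  proper_relative_to (@Pc n R) (fun r i => (score p w r i)%:E) /\
  equitability_constant (fun r i => (score p w r i)%:E) p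
    (\sum_(1 <= k < n.+1) w k * cumprob p k * (1 - cumprob p k)).
Proof.
have equi : equitability_constant (fun r i => (score p w r i)%:E) p
    (\sum_(1 <= k < n.+1) w k * cumprob p k * (1 - cumprob p k)).
  move=> r; rewrite expected_score//; congr (_%:E).
  by apply: eq_bigr => k _; rewrite risk_diag mulrA.
split; first by move=> r i; exact: score_ge0.
split; first by eexists; exact: equi.
split=> // F F' _ _; rewrite !expected_score// lee_fin.
rewrite big_nat [leRHS]big_nat; apply: ler_sum => k /w_ge0 wk.
by rewrite ler_wpM2l// risk_min.
Qed.
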